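(* Let $\mu=\mu_1\otimes\dots\otimes\mu_d$ be a product probability measure on $\mathbb{R}^d$. Let $f,g:\mathbb{R}^d\to\mathbb{R}$ be coordinatewise absolutely continuous functions in $L^2(\mu)$. Then $$\mathrm{Cov}_\mu(f,g)=\sum_{i=1}^d\iint_{x,x'\in\mathbb{R}^d}\partial_i f(x)\,k_{\mu_i}(x_i,x_i')\,\partial_i g(x_1,\dots,x_{i-1},x_i',x_{i+1}',\dots,x_d')\,dx_i\,dx_i'\,d\mu(x_{-i})\,d\mu(x'_{-i}),$$ where $k_{\mu_i}(x_i,x_i')=F_{\mu_i}(x_i\wedge x_i')-F_{\mu_i}(x_i)F_{\mu_i}(x_i')$ for $x_i,x_i'\in\mathbb{R}$.
   Context: $F_{\mu_i}$ is the cumulative distribution function of $\mu_i$ and $x\wedge y=\min(x,y)$. $x_{-i}=(x_1,\dots,x_{i-1},x_{i+1},\dots,x_d)$ and $d\mu(x_{-i})=d\mu_1(x_1)\cdots d\mu_{i-1}(x_{i-1})\,d\mu_{i+1}(x_{i+1})\cdots d\mu_d(x_d)$. Coordinatewise absolutely continuous means absolutely continuous as a function of each coordinate when the others are fixed. $\mathrm{Cov}_\mu(f,g)=\int (f-\int f\,d\mu)(g-\int g\,d\mu)\,d\mu$. Standing convention: functions have enough integrability and regularity for all written quantities to be well defined (in particular, the integrals above converge absolutely). *)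

(* Defs.v *)
From HB Require Import structures.
From mathcomp Require Import all_boot all_order all_algebra.
From mathcomp Require Import all_classical all_reals all_analysis.

Set Implicit Arguments.
Unset Strict Implicit.
Unset Printing Implicit Defensive.

Import Order.TTheory GRing.Theory Num.Theory.
Import numFieldNormedType.Exports.

Local Open Scope classical_set_scope.
Local Open Scope ring_scope.

(* R^d is [d.-tuple R] with its product Borel sigma-algebra. *)

Section product_probability.
Context {R : realType}.

Definition tuple_cons (n : nat) (p : R * n.-tuple R) : n.+1.-tuple R :=
  [tuple of p.1 :: p.2].

Lemma measurable_tuple_cons (n : nat) :
  measurable_fun [set: R * n.-tuple R] (@tuple_cons n).
Proof. exact: measurable_cons. Qed.

HB.instance Definition _ (n : nat) :=
  isMeasurableFun.Build _ _ (R * n.-tuple R)%type (n.+1.-tuple R)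
    (@tuple_cons n) (@measurable_tuple_cons n).

(* The finite product of probability measures is not in the library: it is
   obtained from the binary one by transport along R * R^n -> R^n.+1. *)
Fixpoint product_probability (n : nat) :
    ('I_n -> probability R R) -> probability (n.-tuple R) R :=
  match n with
  | 0 => fun=> \d_([tuple])
  | n'.+1 => fun m =>
      distribution (m ord0 \x product_probability (fun j => m (lift ord0 j)))%E
        (@tuple_cons n')
  end.

Lemma product_probabilityE (n : nat) (m : 'I_n -> probability R R)
    (A : 'I_n -> set R) : (forall i, measurable (A i)) ->
  product_probability m [set x | forall i, A i (tnth x i)] =
  (\prod_(i < n) m i (A i))%E.
Proof.
elim: n m A => [|n IHn] m A mA.
  by rewrite big_ord0/= diracE mem_set// => -[].
rewrite big_ord_recl/= /distribution/= /pushforward.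
rewrite (_ : _ @^-1` _ = A ord0 `*`
    [set y | forall j, A (lift ord0 j) (tnth y j)]); last first.
  apply/seteqP; split => -[t y]/=.
    move=> Aty; split; first exact: (Aty ord0).
    by move=> j; have := Aty (lift ord0 j); rewrite /tuple_cons tnthS.
  move=> [At Ay] i; case: (unliftP ord0 i) => [j|] ->//.
  by rewrite /tuple_cons tnthS.
rewrite product_measure1E//; first by congr (_ * _)%E; exact: IHn.
rewrite (_ : [set _ | _] =
    \bigcap_(j in [set: 'I_n]) (@tnth n R ^~ j @^-1` A (lift ord0 j))).
  apply: fin_bigcap_measurable => // j _; rewrite -[X in measurable X]setTI.
  exact: measurable_tnth.
by apply/seteqP; split => y/= Ay j; [move=> _|]; exact: Ay.
Qed.

End product_probability.

Section coordinates.
Context {R : realType}.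

Definition set_coord (d : nat) (x : d.-tuple R) (i : 'I_d) (t : R) :
    d.-tuple R :=
  [tuple if j == i then t else tnth x j | j < d].

(* The point x of R^d with i-th coordinate t and x_{-i} = y. *)
Definition insert_coord (d : nat) (i : 'I_d) (t : R) (y : d.-1.-tuple R) :
    d.-tuple R :=
  [tuple oapp (tnth y) t (unlift i j) | j < d].

(* (x_1, ..., x_{i-1}, x'_i, ..., x'_d) *)
Definition splice (d : nat) (i : 'I_d) (x x' : d.-tuple R) : d.-tuple R :=
  [tuple if (j < i)%N then tnth x j else tnth x' j | j < d].

Definition partial (d : nat) (i : 'I_d) (f : d.-tuple R -> R)
    (x : d.-tuple R) : R :=
  derive1 (fun t => f (set_coord x i t)) (tnth x i).

End coordinates.

Section absolute_continuity.
Context {R : realType}.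

Definition absolutely_continuous_on (a b : R) (h : R -> R) : Prop :=
  forall e : R, 0 < e -> exists2 delta : R, 0 < delta &
    forall (n : nat) (u v : 'I_n -> R),
      (forall k, a <= u k /\ u k <= v k /\ v k <= b) ->
      trivIset [set: 'I_n] (fun k => `]u k, v k[%classic) ->
      \sum_(k < n) (v k - u k) < delta ->
      \sum_(k < n) `|h (v k) - h (u k)| < e.

(* On the whole line absolute continuity is understood on compact intervals,
   as is usual; a uniform delta would exclude even t |-> t ^+ 2. *)
Definition absolutely_continuous (h : R -> R) : Prop :=
  forall a b : R, absolutely_continuous_on a b h.

Definition coordinatewise_absolutely_continuous (d : nat)
    (f : d.-tuple R -> R) : Prop :=
  forall (i : 'I_d) (x : d.-tuple R),
    absolutely_continuous (fun t => f (set_coord x i t)).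

End absolute_continuity.

Section kernel.
Context {R : realType}.

Definition distribution_function (m : probability R R) (t : R) : R :=
  fine (m `]-oo, t]%classic).

Definition covariance_kernel (m : probability R R) (s t : R) : R :=
  distribution_function m (Num.min s t) -
  distribution_function m s * distribution_function m t.

Variables (d : nat) (m : 'I_d -> probability R R) (i : 'I_d).

(* mu_{-i}, the product of the mu_j over j != i, on R^(d-1) *)
Definition product_probability_except : probability (d.-1.-tuple R) R :=
  product_probability (fun j => m (lift i j)).

(* dmu(x_{-i}) dmu(x'_{-i}) *)
Definition product_probability_except2 :
    probability (d.-1.-tuple R * d.-1.-tuple R)%type R :=
  (product_probability_except \x product_probability_except)%E.

(* dx_i dx'_i dmu(x_{-i}) dmu(x'_{-i}).
   [lebesgue_measure] lives on [measurableTypeR R], which is convertible to R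
   and carries the same Borel sets, but under another display. *)
Definition representation_measure :
    {measure set ((measurableTypeR R * measurableTypeR R) *
                  (d.-1.-tuple R * d.-1.-tuple R))%type -> \bar R} :=
  ((lebesgue_measure \x lebesgue_measure) \x product_probability_except2)%E.

(* z = ((x_i, x'_i), (x_{-i}, x'_{-i})) *)
Definition representation_integrand (f g : d.-tuple R -> R)
    (z : (measurableTypeR R * measurableTypeR R) *
         (d.-1.-tuple R * d.-1.-tuple R)) : R :=
  let x := insert_coord i z.1.1 z.2.1 in
  let x' := insert_coord i z.1.2 z.2.2 in
  partial i f x * covariance_kernel (m i) (tnth x i) (tnth x' i) *
  partial i g (splice i x x').

End kernel.

(* Main.v *)
Require Import Defs.
From HB Require Import structures.
From mathcomp Require Import all_boot all_order all_algebra.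
From mathcomp Require Import all_classical all_reals all_analysis.
From mathcomp Require Import measurable_realfun lra.
Import Order.TTheory GRing.Theory Num.Theory.
Import numFieldNormedType.Exports.
Local Open Scope classical_set_scope.
Local Open Scope ring_scope.

Set Implicit Arguments.
Unset Strict Implicit.
Unset Printing Implicit Defensive.

(** Let [X] and [X'] be independent with law [mu], and let [S_k] be the point
    that agrees with [X] before index [k] and with [X'] from [k] on. Then
    [Cov(f, g) = E (f(X) (g(X) - g(X')))], and [g(X) - g(X')] telescopes into
    the increments [g(S_(i+1)) - g(S_i)], in which a single coordinate moves
    from [X'_i] to [X_i] (lemma [covariance_telescope]). Once all other
    coordinates of [X] and [X'] are fixed, the [i]-th term is, for the sections
    [phi] and [psi] of [f] and [g],
    [E (phi(X_i) (psi(X_i) - psi(X'_i)))], the covariance of two functions of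
    one variable, and everything reduces to Hoeffding's formula
    [Cov(phi, psi) = \int \int phi'(s) k(s, t) psi'(t) ds dt]
    (lemma [hoeffding_formula]) integrated over the remaining coordinates
    (lemma [integral_increment]).

    For Hoeffding's formula, exchanging the two variables turns the left-hand
    side into the integral of [(phi(x) - phi(x')) (psi(x) - psi(x'))] over the
    half plane [x' < x]. Each factor is the integral of the derivative over
    [[x', x[], so Fubini's theorem brings out the probability of
    [x' <= min(s, t), max(s, t) < x], which is
    [F(min(s, t)) (1 - F(max(s, t))) = k(s, t)]. Since this weight is
    nonnegative, the absolute convergence that Fubini's theorem asks for is
    exactly the assumed integrability of [phi' k psi'].

    It remains to know that an absolutely continuous function is differentiable
    almost everywhere and is the integral of its derivative (lemma
    [locally_ac_derivative]). Its total variation [V], and [V] minus the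
    function, are monotone and absolutely continuous; the Stieltjes measure of
    such a function gives small mass to bounded open sets of small length, hence
    is dominated by the Lebesgue measure; the Radon-Nikodym theorem yields a
    density, and Lebesgue's differentiation theorem identifies it with the
    derivative. *)

(** * Absolute continuity through finite families of intervals *)

Section interval_families.
Context {R : realType}.
Implicit Types (a b u v e : R) (s t : seq (R * R)) (f g : R -> R).

Definition nonoverlapping (p q : R * R) := (p.2 <= q.1) || (q.2 <= p.1).

Definition interval_family a b s :=
  all (fun p => [&& a <= p.1, p.1 <= p.2 & p.2 <= b]) s &&
  pairwise nonoverlapping s.

Definition increments f s := \sum_(p <- s) `|f p.2 - f p.1|.

(** The same epsilon-delta condition with lists instead of indexed families:
    refining one interval of a family is then a concatenation. *)
Definition locally_ac f := forall a b e, 0 < e ->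
  exists2 delta : R, 0 < delta & forall s, interval_family a b s ->
    \sum_(p <- s) (p.2 - p.1) < delta -> increments f s <= e.

Lemma nonoverlapping_sym : symmetric nonoverlapping.
Proof. by move=> p q; rewrite /nonoverlapping orbC. Qed.

Lemma absolutely_continuous_locally_ac f :
  absolutely_continuous f -> locally_ac f.
Proof.
move=> fac a b e e0; have [delta d0 H] := fac a b e e0.
exists delta => // s /andP[/allP sab sdisj].
rewrite /increments (big_nth (0, 0)) big_mkord => sd.
rewrite (big_nth (0, 0)) big_mkord ltW//.
apply: (H (size s) (fun k => (nth (0, 0) s k).1) (fun k => (nth (0, 0) s k).2)).
- by move=> k; have /sab/and3P[] := mem_nth (0, 0) (ltn_ord k).
- apply/trivIsetP => i j _ _ ij; apply/seteqP; split => // x [] /=.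
  rewrite !in_itv/= => /andP[ix xi] /andP[jx xj].
  wlog ltij : i j ij ix xi jx xj / (i < j)%N => [wh|].
    have [ij'|ji'|/val_inj eij] := ltngtP i j; first exact: (wh i j).
      by apply: (wh j i) => //; rewrite eq_sym.
    by rewrite eij eqxx in ij.
  move/(pairwiseP (0, 0)) : sdisj => /(_ i j).
  rewrite !inE => /(_ (ltn_ord i) (ltn_ord j) ltij) /orP[].
    by move=> /(lt_le_trans xi)/lt_trans/(_ jx); rewrite ltxx.
  by move=> /(lt_le_trans xj)/lt_trans/(_ ix); rewrite ltxx.
- exact: sd.
Qed.

Lemma increments_cat f s t :
  increments f (s ++ t) = increments f s + increments f t.
Proof. exact: big_cat. Qed.

Lemma locally_acB f g : locally_ac f -> locally_ac g ->
  locally_ac (fun x => f x - g x).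
Proof.
move=> facl gacl a b e e0.
have e20 : 0 < e / 2 by rewrite divr_gt0.
have [d1 d10 H1] := facl a b _ e20.
have [d2 d20 H2] := gacl a b _ e20.
exists (Num.min d1 d2); first by rewrite lt_min d10.
move=> s sab; rewrite lt_min => /andP[sd1 sd2].
rewrite (splitr e); apply: le_trans (lerD (H1 s sab sd1) (H2 s sab sd2)).
rewrite /increments -big_split/=; apply: ler_sum => p _.
rewrite (_ : _ - _ = (f p.2 - f p.1) - (g p.2 - g p.1)); last by lra.
exact: ler_normB.
Qed.


Definition map_max a s := [seq (Num.max a p.1, Num.max a p.2) | p <- s].

Lemma interval_family_map_max a b c s : interval_family b c s ->
  interval_family a (Num.max a c) (map_max a s).
Proof.
move=> /andP[sbc sdisj]; apply/andP; split.
  rewrite all_map; apply: sub_all sbc => p /= /and3P[bp pp pc].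
  by rewrite le_max lexx/= !ge_max !le_max !lexx pp pc !orbT.
rewrite pairwise_map; apply: sub_pairwise sdisj => p q /=.
rewrite /nonoverlapping/= => /orP[pq|qp]; apply/orP; [left|right].
  by rewrite ge_max !le_max lexx pq orbT.
by rewrite ge_max !le_max lexx qp orbT.
Qed.

Lemma map_max_length a b c s : interval_family b c s ->
  \sum_(p <- map_max a s) (p.2 - p.1) <= \sum_(p <- s) (p.2 - p.1).
Proof.
move=> /andP[/allP sbc _]; rewrite big_map big_seq [leRHS]big_seq.
apply: ler_sum => p /sbc /and3P[_ + _]; set x := p.1; set y := p.2 => xy /=.
by rewrite /Order.max; case: ltP => ?; case: ltP => ?; lra.
Qed.

(** Clamping at [a] moves end points together and keeps intervals from
    overlapping. It makes functions that start at [a] total on the line. *)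
Lemma locally_ac_max a f : locally_ac f -> locally_ac (fun x => f (Num.max a x)).
Proof.
move=> fac b c e e0; have [d d0 H] := fac a (Num.max a c) e e0.
exists d => // s sbc sd; rewrite -[leLHS](_ : increments f (map_max a s) = _).
  apply: H; first exact: interval_family_map_max sbc.
  exact: le_lt_trans (map_max_length a sbc) sd.
by rewrite /increments big_map.
Qed.

Fixpoint steps u (s : seq R) : seq (R * R) :=
  if s is x :: s' then (u, x) :: steps x s' else [::].

Lemma steps_length u (r : seq R) : \sum_(p <- steps u r) (p.2 - p.1) = last u r - u.
Proof.
elim: r u => [|x s ih] u /=; first by rewrite big_nil subrr.
by rewrite big_cons/= ih; lra.
Qed.

Lemma steps_family u (r : seq R) : path <%R u r ->
  interval_family u (last u r) (steps u r).
Proof.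
elim: r u => [|x s ih] u //= /andP[ux xs].
have /andP[/allP sx dx] := ih _ xs.
have xl : x <= last x s.
  have := steps_length x s; rewrite -subr_ge0 => <-.
  by rewrite big_seq; apply: sumr_ge0 => p /sx/and3P[]; rewrite subr_ge0.
apply/and3P; split => /=.
- rewrite lexx (ltW ux) xl/=; apply/allP => p /sx /and3P[xp pp pl].
  by rewrite (le_trans (ltW ux) xp) pp.
- by apply/allP => p /sx /and3P[xp _ _]; rewrite /nonoverlapping/= xp.
- exact: dx.
Qed.

Lemma variation_steps a b f (r : seq R) : itv_partition a b r ->
  variation a b f r = increments f (steps a r).
Proof.
move=> abs; rewrite (variation_zip f abs) /increments.
elim: r a {abs} => [|x s ih] a /=; first by rewrite !big_nil.
by rewrite !big_cons ih.
Qed.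

Notation TV := total_variation.

(** Refining an interval keeps the total length fixed, so a bound on the
    increments of all short families bounds their total variations too. The
    intervals of [s] are those still to be refined, those of [t] are final; the
    supremum over the subdivisions is taken one interval at a time. *)
Lemma total_variation_family a b f e delta :
  (forall s, interval_family a b s ->
     \sum_(p <- s) (p.2 - p.1) < delta -> increments f s <= e) ->
  forall s t, interval_family a b (s ++ t) ->
    \sum_(p <- s ++ t) (p.2 - p.1) < delta ->
    (\sum_(p <- s) TV p.1 p.2 f + (increments f t)%:E <= e%:E)%E.
Proof.
move=> H; elim=> [|[u v] s ih] t /=.
  by rewrite big_nil add0e lee_fin; exact: H.
rewrite big_cons => fst sd.
move: (fst) => /andP[/=/andP[/and3P[au uv vb] ast] /andP[uvst dst]].
rewrite big_cons/= -addeA.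
set T := (\sum_(p <- s) _)%E.
have T0 : (0 <= T)%E.
  rewrite /T big_seq; apply: sume_ge0 => p ps; apply: total_variation_ge0.
  by move/allP : ast => /(_ p); rewrite mem_cat ps => /(_ isT)/and3P[].
have Te r : itv_partition u v r ->
    (T + (increments f (steps u r ++ t))%:E <= e%:E)%E.
  move=> uvr; case: (uvr) => ur /eqP rv.
  have /andP[/allP sur dr] := steps_family ur.
  rewrite rv in sur.
  apply: ih.
    apply/andP; split.
      move: ast; rewrite !all_cat => /andP[-> ->] /=; rewrite andbT.
      apply/allP => p /sur /and3P[up pp pv].
      by rewrite (le_trans au up) pp (le_trans pv vb).
    move: dst; rewrite !pairwise_cat => /and3P[st ds dt].
    move: uvst; rewrite all_cat => /andP[uvs uvt].
    have sub w p : nonoverlapping (u, v) w -> p \in steps u r ->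
        nonoverlapping p w.
      move=> + /sur /and3P[up pp pv]; rewrite /nonoverlapping/= => /orP[vw|wu].
        by rewrite (le_trans pv vw).
      by rewrite (le_trans wu up) orbT.
    rewrite allrel_catr st ds dt dr !andbT/= .
    apply/andP; split.
      apply/allrelP => p q ps qs; rewrite nonoverlapping_sym; apply: sub qs.
      by move/allP : uvs => /(_ _ ps).
    apply/allrelP => p q ps qs; apply: sub ps.
    by move/allP : uvt => /(_ _ qs).
  move: sd; rewrite !big_cat/= steps_length rv => sd.
  by rewrite addrCA.
(* subtracting [T] to isolate the supremum requires it to be finite *)
have [Tfin|Tinf] := boolP (T \is a fin_num); last first.
  have /eqP TE : T == +oo%E.
    move: Tinf; rewrite fin_numE negb_and !negbK => /orP[/eqP TN|//].
    by rewrite TN in T0.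
  move: uv; rewrite le_eqVlt => /predU1P[uv|uv].
    by have := Te [::] (conj isT (introT eqP uv)); rewrite TE addye// leye_eq.
  by have := Te [:: v] (itv_partition1 uv); rewrite TE addye// leye_eq.
rewrite -(fineK Tfin) -EFinD addeC -leeBrDl// -EFinB.
apply: ge_ereal_sup => _ [_ [r uvr <-] <-].
have := Te r uvr; rewrite -(fineK Tfin) (variation_steps f uvr) !lee_fin.
by rewrite increments_cat; lra.
Qed.

End interval_families.

(** * Total variation of an absolutely continuous function *)

Section variation_of_ac.
Context {R : realType}.
Implicit Types (a b u v e : R) (s t : seq (R * R)) (f g : R -> R).
Notation TV := total_variation.

(** Cut [[a, b]] into pieces of length [d / 2]: the variation is at most 1 on
    each of them. *)
Lemma locally_ac_total_variation_lty f a b : locally_ac f -> a <= b ->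
  (TV a b f < +oo)%E.
Proof.
move=> fac ab; have [d d0 H] := fac a b 1 ltr01.
have short u v : a <= u -> u <= v -> v <= b -> v - u < d -> (TV u v f < +oo)%E.
  move=> au uv vb uvd.
  have := total_variation_family H (s := [:: (u, v)]) (t := [::]).
  rewrite cats0 !big_seq1/= /increments big_nil adde0 => h.
  apply: le_lt_trans (ltry 1); apply: h => //.
  by rewrite /interval_family/= au uv vb.
have d20 : 0 < d / 2 by rewrite divr_gt0.
suff : forall n v, a <= v -> v <= b -> v - a <= (d / 2) *+ n ->
    (TV a v f < +oo)%E.
  move=> /(_ (Num.bound ((b - a) / (d / 2))) b ab (lexx _)); apply.
  rewrite -mulr_natr mulrC -ler_pdivrMr//.
  apply: ltW; apply: archi_boundP; rewrite divr_ge0// ?subr_ge0// ltW//.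
elim=> [|n ih] v av vb; rewrite ?mulr0n ?[_ *+ n.+1]mulrS => van.
  have -> : v = a by apply/eqP; rewrite eq_le av andbT; lra.
  by rewrite total_variationxx ltry.
have [vd|vd] := lerP (v - d / 2) a.
  by apply: short => //; lra.
have vdv : v - d / 2 <= v by lra.
rewrite (total_variationD _ (ltW vd) vdv).
rewrite lte_add_pinfty//; last by apply: short => //; lra.
apply: ih; [exact: ltW|lra|].
by rewrite addrAC lerBlDl.
Qed.

Lemma locally_ac_total_variation_fin f a b : locally_ac f -> a <= b ->
  TV a b f \is a fin_num.
Proof.
move=> fac ab; rewrite ge0_fin_numE ?total_variation_ge0//.
exact: locally_ac_total_variation_lty.
Qed.

(** The clamp makes this function monotone on the whole line, as the generating
    function of a Stieltjes measure has to be. *)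
Definition variation_from a f x := fine (TV a (Num.max a x) f).

Lemma variation_fromB a f x y : locally_ac f -> x <= y ->
  variation_from a f y - variation_from a f x =
  fine (TV (Num.max a x) (Num.max a y) f).
Proof.
move=> fac xy; rewrite /variation_from.
have ax : a <= Num.max a x by rewrite le_max lexx.
have xy' : Num.max a x <= Num.max a y.
  by rewrite ge_max !le_max lexx xy orbT.
rewrite (total_variationD _ ax xy') fineD ?locally_ac_total_variation_fin//.
by rewrite addrAC subrr add0r.
Qed.

Lemma variation_from_nondecreasing a f : locally_ac f ->
  {homo variation_from a f : x y / x <= y}.
Proof.
move=> fac x y xy; rewrite -subr_ge0 variation_fromB// fine_ge0//.
by apply: total_variation_ge0; rewrite ge_max !le_max lexx xy orbT.
Qed.

Lemma ler_variation_from a f x y : locally_ac f -> x <= y ->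
  `|f (Num.max a y) - f (Num.max a x)| <=
  variation_from a f y - variation_from a f x.
Proof.
move=> fac xy; rewrite variation_fromB// -lee_fin.
have xy' : Num.max a x <= Num.max a y.
  by rewrite ge_max !le_max lexx xy orbT.
rewrite fineK; first exact: total_variation_ge.
exact: locally_ac_total_variation_fin.
Qed.

Lemma locally_ac_variation_from a f : locally_ac f ->
  locally_ac (variation_from a f).
Proof.
move=> fac b c e e0; have [d d0 H] := fac a (Num.max a c) e e0.
exists d => // s sbc sd.
have := total_variation_family H (s := map_max a s) (t := [::]).
rewrite cats0 => /(_ (interval_family_map_max a sbc)).
move=> /(_ (le_lt_trans (map_max_length a sbc) sd)).
rewrite [increments f [::]]big_nil adde0 -[_ <= e]lee_fin; apply: le_trans.
rewrite /increments big_map -sumEFin big_seq [leRHS]big_seq.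
apply: lee_sum => p ps /=.
have /andP[/allP/(_ _ ps)/and3P[_ pp _] _] := sbc.
rewrite variation_fromB// ger0_norm; last first.
  by rewrite fine_ge0// total_variation_ge0// ge_max !le_max lexx pp orbT.
by rewrite fineK// locally_ac_total_variation_fin// ge_max !le_max lexx pp orbT.
Qed.

Lemma locally_ac_continuous f : locally_ac f -> continuous f.
Proof.
move=> fac x; apply/cvgrPdist_le => /= e e0.
have [d d0 H] := fac (x - 1) (x + 1) e e0.
near=> y.
have xy1 : `|x - y| < 1 by near: y; apply/nbhs_ballP; exists 1 => /=.
have xyd : `|x - y| < d by near: y; apply/nbhs_ballP; exists d.
move: xy1 xyd; rewrite !ltr_norml => /andP[h1 h2] /andP[h3 h4].
have [xy|yx] := leP x y.
  have := H [:: (x, y)]; rewrite /increments !big_seq1/= distrC; apply; last by lra.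
  by rewrite /interval_family/= xy !andbT; apply/andP; split; lra.
have := H [:: (y, x)]; rewrite /increments !big_seq1/=; apply; last by lra.
by rewrite /interval_family/= (ltW yx) !andbT/=; apply/andP; split; lra.
Unshelve. all: by end_near. Qed.

End variation_of_ac.

(** * Stieltjes measures of absolutely continuous monotone functions *)

Section monotone_ac.
Context {R : realType}.
Implicit Types (a b u v e : R).

(** An empty piece is placed at [a], the left end of the ambient interval, where
    it overlaps no other piece. *)
Lemma open_bounded_itv (I : set R) (a b : R) : open I -> is_interval I ->
  I `<=` `]a, b[ -> exists p : R * R,
    [/\ [&& a <= p.1, p.1 <= p.2 & p.2 <= Num.max a b], I = `]p.1, p.2[%classic &
        p = (a, a) \/ p.1 < p.2].
Proof.
move=> oI iI Iab.
have [->|/set0P I0] := eqVneq I set0.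
  exists (a, a); split; [|by rewrite set_itv_ge// bnd_simp ltxx|by left].
  by rewrite /= !lexx le_max lexx.
have lI : has_lbound I by exists a => x /Iab/=; rewrite in_itv/= => /andP[/ltW].
have uI : has_ubound I by exists b => x /Iab/=; rewrite in_itv/= => /andP[_ /ltW].
have IE : I = `]inf I, sup I[%classic.
  by rewrite -interval_bounded_interior//; apply/esym/interior_id.
have [x Ix] := I0.
have /andP[ix xs] : inf I < x < sup I by move: Ix; rewrite {1}IE /= in_itv.
exists (inf I, sup I); split => //=; last by right; exact: lt_trans xs.
rewrite (ltW (lt_trans ix xs)) le_max; apply/and3P; split => //.
  by apply: lb_le_inf => // y /Iab; rewrite /= in_itv => /andP[/ltW].
apply/orP; right.
by apply: ge_sup => // y /Iab; rewrite /= in_itv => /andP[_ /ltW].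
Qed.

(** Otherwise the midpoint of the overlap would be common to both. This fails
    for an empty interval inside the other one, hence the two hypotheses. *)
Lemma disjoint_open_itv_nonoverlapping (p q : R * R) :
  p.1 < p.2 -> q.1 < q.2 ->
  `]p.1, p.2[%classic `&` `]q.1, q.2[%classic = set0 -> nonoverlapping p q.
Proof.
move: p q => [u v] [u' v']; rewrite /nonoverlapping/= => uv uv' disj.
apply/orP; have [vu|uv1] := leP v u'; [by left|right].
rewrite leNgt; apply/negP => uv2.
set M := Num.max u u'; set m := Num.min v v'.
have Mm : M < m by rewrite lt_min !gt_max uv uv1 uv2 uv'.
have [uM u'M] : u <= M /\ u' <= M by rewrite !le_max !lexx orbT.
have [mv mv'] : m <= v /\ m <= v' by rewrite !ge_min !lexx orbT.
have : set0 ((M + m) / 2).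
  by rewrite -disj /= !in_itv/=; split; apply/andP; split; lra.
by [].
Qed.

Lemma lebesgue_stieltjes_measure_itvoc (f : cumulative R R) (a b : R) : a <= b ->
  lebesgue_stieltjes_measure f `]a, b]%classic = (f b - f a)%:E.
Proof.
move=> ab; rewrite /lebesgue_stieltjes_measure/= /measure_extension/=.
rewrite measurable_mu_extE/=; last exact: is_ocitv.
by rewrite wlength_itv_bnd.
Qed.

Section domination.
Variable G : cumulative R R.
Hypothesis Gac : locally_ac G.
Let mu := @lebesgue_measure R.
Let nu := lebesgue_stieltjes_measure G.

(** An open set is a disjoint union of open intervals, whose total length is its
    measure; finitely many of them form a family to which absolute continuity
    applies. *)
Lemma stieltjes_open_le (a b e : R) : 0 < e ->
  exists2 delta : R, 0 < delta & forall U, open U -> U `<=` `]a, b[ ->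
    (mu U < delta%:E)%E -> (nu U <= e%:E)%E.
Proof.
move=> e0; have [delta d0 H] := Gac a (Num.max a b) e0.
exists delta => // U oU Uab mUd.
pose I := open_disjoint_itv oU.
have IU q : I q `<=` U.
  by move=> x Iqx; rewrite (open_disjoint_itv_bigcup oU); exists q.
have /choice[p pP] : forall q, exists p : R * R,
    [/\ [&& a <= p.1, p.1 <= p.2 & p.2 <= Num.max a b], I q = `]p.1, p.2[%classic &
        p = (a, a) \/ p.1 < p.2].
  move=> q; apply: open_bounded_itv.
  - exact: open_disjoint_itv_open.
  - exact: open_disjoint_itv_is_interval.
  - exact: subset_trans (IU q) Uab.
have mI q : measurable (I q).
  by case: (pP q) => _ -> _; exact: measurable_itv.
have tI : trivIset setT I by exact: open_disjoint_itv_trivIset.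
have UE : U = \bigcup_q I q by exact: open_disjoint_itv_bigcup.
have fam n : interval_family a (Num.max a b) [seq p q | q <- iota 0 n].
  apply/andP; split.
    by rewrite all_map; apply/allP => q _ /=; case: (pP q).
  rewrite pairwise_map; apply/(pairwiseP 0%N) => i j.
  rewrite !inE size_iota => ni nj ij; rewrite !nth_iota// !add0n/=.
  case: (pP i) (pP j) => + Ii + [+ Ij +] => ai pi aj pj.
  case: pi => [pia|pi].
    by rewrite /nonoverlapping pia/=; move: aj => /and3P[->].
  case: pj => [pja|pj].
    by rewrite /nonoverlapping pja/=; move: ai => /and3P[->]; rewrite orbT.
  apply: disjoint_open_itv_nonoverlapping => //; rewrite -Ii -Ij.
  by move/trivIsetP : tI; apply => //; rewrite lt_eqF.
have len n : \sum_(r <- [seq p q | q <- iota 0 n]) (r.2 - r.1) < delta.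
  rewrite -lte_fin; apply: le_lt_trans mUd.
  rewrite big_map -sumEFin.
  have -> : (\sum_(i <- iota 0 n) ((p i).2 - (p i).1)%:E)%E =
      (\sum_(i < n) mu (I i))%E.
    rewrite -(big_mkord xpredT (fun i => mu (I i))) /index_iota subn0.
    apply: eq_bigr => i _; case: (pP i) => /and3P[_ pp _] -> _.
    rewrite /mu lebesgue_measure_itv/= lte_fin.
    case: ltP => // h; have -> : (p i).1 = (p i).2.
      by apply/eqP; rewrite eq_le pp.
    by rewrite subrr.
  rewrite -(@measure_bigsetU _ _ _ mu)//.
  apply: le_measure; rewrite ?inE.
  - by apply: bigsetU_measurable => i _; exact: mI.
  - exact: open_measurable.
  - by rewrite -(bigcup_mkord n I) => x [q _ /IU].
have mU : nu U = (\sum_(0 <= q <oo) nu (I q))%E.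
  rewrite UE; transitivity (\sum_(i <oo | i \in [set: nat]) nu (I i))%E.
    by have := @measure_bigcup _ _ _ nu setT I (fun q _ => mI q) tI.
  by apply: eq_eseriesl => q; rewrite in_setT.
rewrite mU; apply: lime_le; first exact: is_cvg_nneseries.
apply: nearW => n; have := H _ (fam n) (len n).
rewrite -lee_fin; apply: le_trans.
rewrite /increments big_map -sumEFin /index_iota subn0; apply: lee_sum => q _.
case: (pP q) => /and3P[_ pp _] -> _.
have -> : `|G (p q).2 - G (p q).1| = G (p q).2 - G (p q).1.
  by rewrite ger0_norm// subr_ge0; exact: cumulative_is_nondecreasing.
rewrite -lebesgue_stieltjes_measure_itvoc//.
by apply: le_measure; rewrite ?inE//; exact: subset_itv_oo_oc.
Qed.

Lemma stieltjes_null (a b : R) N : measurable N -> N `<=` `]a, b[ ->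
  mu N = 0%E -> nu N = 0%E.
Proof.
move=> mN Nab N0; apply/eqP; rewrite eq_le measure_ge0 andbT.
apply/lee_addgt0Pr => e e0; rewrite add0e.
have [delta d0 H] := stieltjes_open_le a b e0.
have N0' : (mu N < +oo)%E by rewrite N0 ltry.
have [U [oU NU UN]] := lebesgue_regularity_outer mN N0' d0.
have oV : open (U `&` `]a, b[%classic).
  by apply: openI => //; exact: interval_open.
apply: (@le_trans _ _ (nu (U `&` `]a, b[%classic))).
  apply: le_measure; rewrite ?inE//; first exact: open_measurable.
  by rewrite subsetI.
apply: H; [exact: oV|by move=> x []|].
apply: (@le_lt_trans _ _ (mu (N `|` (U `\` N)))).
  apply: le_measure; rewrite ?inE.
  - exact: open_measurable.
  - by apply: measurableU => //; apply: measurableD => //; exact: open_measurable.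
  - by move=> x [Ux _]; have [Nx|nNx] := pselect (N x); [left|right].
apply: le_lt_trans UN.
have mUN : measurable (U `\` N).
  by apply: measurableD => //; exact: open_measurable.
have NUN : N `&` (U `\` N) = set0 by rewrite setIDA setIC -setIDA setDv setI0.
have -> : mu (N `|` (U `\` N)) = (mu N + mu (U `\` N))%E.
  exact: (@measureU _ _ _ mu _ _ mN mUN NUN).
by rewrite N0 add0e.
Qed.

End domination.

End monotone_ac.

(** * Densities on a bounded interval *)

Section density.
Context {R : realType}.
Implicit Types (a b u v e : R).
Notation mu := (@lebesgue_measure R).

Definition density_on a b (f h : R -> R) := forall x y, a <= x -> x <= y -> y <= b ->
    (\int[mu]_(t in `]x, y]) (h t)%:E)%E = (f y - f x)%:E.

(** Between [a] and [b] the Stieltjes measure is finite and dominated by the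
    Lebesgue measure; the density is its Radon-Nikodym derivative. *)
Lemma monotone_ac_density_on (G : R -> R) a b :
  {homo G : x y / x <= y} -> locally_ac G ->
  exists2 h : R -> R, mu.-integrable setT (EFin \o h) & density_on a b G h.
Proof.
move=> ndG Gac.
pose Gm := isCumulative.Build R _ R G ndG
  (right_continuousW (locally_ac_continuous Gac)).
pose Gc : cumulative R R := HB.pack G Gm.
pose nu : {measure set (measurableTypeR R) -> \bar R} :=
  lebesgue_stieltjes_measure Gc.
have mD : measurable (`]a, b]%classic : set (measurableTypeR R)).
  exact: measurable_itv.
have nuD : (nu `]a, b]%classic < +oo)%E.
  have [ab|ba] := leP a b.
    have -> : nu `]a, b]%classic = (G b - G a)%:E.
      exact: (lebesgue_stieltjes_measure_itvoc Gc ab).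
    by rewrite ltry.
  rewrite set_itv_ge ?bnd_simp -?leNgt ?(ltW ba)//.
  by have -> : nu set0 = 0%E by exact: measure0.
pose nuf : {finite_measure set (measurableTypeR R) -> \bar R} := mfrestr mD nuD.
have dom : charge_of_finite_measure nuf `<< mu.
  apply/null_content_dominatesP => N mN N0.
  rewrite /charge_of_finite_measure /nuf /= /mfrestr /mrestr.
  apply: (@stieltjes_null _ Gc Gac a (b + 1)).
  - exact: measurableI.
  - move=> x [_] /=; rewrite !in_itv/= => /andP[-> xb]/=.
    by rewrite (le_lt_trans xb)// ltrDl.
  - by apply: subset_measure0 N0 => //; exact: measurableI.
exists (fine \o Radon_Nikodym (charge_of_finite_measure nuf) mu).
  apply: eq_integrable (Radon_Nikodym_integrable dom) => //.
  by move=> x _ /=; rewrite fineK// Radon_Nikodym_fin_num.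
move=> x y ax xy yb.
under eq_integral do rewrite /= fineK ?Radon_Nikodym_fin_num//.
have mxy : measurable (`]x, y]%classic : set R) by exact: measurable_itv.
have := Radon_Nikodym_integral dom mxy => <-.
rewrite /charge_of_finite_measure /nuf /= /mfrestr /mrestr.
rewrite setIidl.
  exact: (lebesgue_stieltjes_measure_itvoc Gc xy).
move=> z /=; rewrite !in_itv/= => /andP[xz zy].
by rewrite (le_lt_trans ax xz) (le_trans zy yb).
Qed.

(** Jordan decomposition: [f] is the difference of [V] and [V - f] on [[a, b]],
    where [V] is the variation of [f] since [a]. *)
Lemma locally_ac_density_on (f : R -> R) a b : locally_ac f ->
  exists2 h : R -> R, mu.-integrable setT (EFin \o h) & density_on a b f h.
Proof.
move=> fac.
have Vac := locally_ac_variation_from a fac.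
have ndV := variation_from_nondecreasing a fac.
have [h1 ih1 H1] := monotone_ac_density_on a b ndV Vac.
have ndW :
    {homo (fun x => variation_from a f x - f (Num.max a x)) : x y / x <= y}.
  move=> x y xy; have := ler_variation_from a fac xy.
  by move=> /ler_normlP[_]; lra.
have Wac := locally_acB Vac (locally_ac_max a fac).
have [h2 ih2 H2] := monotone_ac_density_on a b ndW Wac.
exists (h1 \- h2).
  by apply: eq_integrable (integrableB _ ih1 ih2).
move=> x y ax xy yb.
have -> : f y - f x = (variation_from a f y - variation_from a f x) -
    ((variation_from a f y - f (Num.max a y)) -
     (variation_from a f x - f (Num.max a x))).
  by rewrite !max_r ?(le_trans ax)//; lra.
have mxy : measurable (`]x, y]%classic : set (measurableTypeR R)).
  exact: measurable_itv.
have i1 := integrableS measurableT mxy (@subsetT _ _) ih1.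
have i2 := integrableS measurableT mxy (@subsetT _ _) ih2.
by rewrite EFinB -H1// -H2// -(integralB_EFin mxy i1 i2).
Qed.

End density.

(** * Properties that hold almost everywhere *)

Lemma ae_mono d (T : measurableType d) (R : realType)
    (m : {measure set T -> \bar R}) (P Q : T -> Prop) :
  (forall x, P x -> Q x) -> {ae m, forall x, P x} -> {ae m, forall x, Q x}.
Proof. by move=> PQ; apply: filterS; exact: PQ. Qed.

Lemma ae_mono2 d (T : measurableType d) (R : realType)
    (m : {measure set T -> \bar R}) (P Q S : T -> Prop) :
  (forall x, P x -> Q x -> S x) ->
  {ae m, forall x, P x} -> {ae m, forall x, Q x} -> {ae m, forall x, S x}.
Proof. by move=> PQS; apply: filterS2; exact: PQS. Qed.

Lemma ae_eq_integrable d (T : measurableType d) (R : realType)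
    (m : {measure set T -> \bar R}) (D : set T) (f g : T -> \bar R) :
  measurable D -> measurable_fun D g -> ae_eq m D f g ->
  m.-integrable D f -> m.-integrable D g.
Proof.
move=> mD mg fg /integrableP[mf foo]; apply/integrableP; split => //.
rewrite (le_lt_trans _ foo)// le_eqVlt; apply/orP; left; apply/eqP.
apply: ae_eq_integral => //; [exact: measurableT_comp..|].
by apply: filterS fg => x fg Dx; rewrite fg.
Qed.

Section ae_products.
Context d1 d2 (T1 : measurableType d1) (T2 : measurableType d2) (R : realType).
Variables (m1 : {measure set T1 -> \bar R})
          (m2 : {sigma_finite_measure set T2 -> \bar R}).

Lemma ae_prod1 (P : T1 -> Prop) : {ae m1, forall x, P x} ->
  {ae (m1 \x m2)%E, forall z, P z.1}.
Proof.
move=> [N [mN N0 PN]]; exists (N `*` setT); split.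
- exact: measurableX.
- by rewrite product_measure1E// [X in (X * _)%E]N0 mul0e.
- by move=> z nPz; split => //; exact: PN.
Qed.

Lemma ae_prod2 (P : T2 -> Prop) : {ae m2, forall x, P x} ->
  {ae (m1 \x m2)%E, forall z, P z.2}.
Proof.
move=> [N [mN N0 PN]]; exists (setT `*` N); split.
- exact: measurableX.
- by rewrite product_measure1E// [X in (_ * X)%E]N0 mule0.
- by move=> z nPz; split => //; exact: PN.
Qed.

End ae_products.

(** * The derivative of an absolutely continuous function *)


Section derivative_density.
Context {R : realType}.
Implicit Types (a b u v e : R).
Notation mu := (@lebesgue_measure R).

(** Being an upper limit of continuous functions, it is measurable, and it
    agrees with the derivative wherever there is one; the values of [derive1] elsewhere
    are not controlled. *)
Definition upper_derivative (f : R -> R) (x : R) : R :=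
  fine (limn_esup (fun k => ((f (x + k.+1%:R^-1) - f x) * k.+1%:R)%:E)).

Lemma measurable_upper_derivative (f : R -> R) : continuous f ->
  measurable_fun [set: R] (upper_derivative f).
Proof.
move=> cf; apply: measurableT_comp => //.
apply: measurable_fun_limn_esup => k; apply/measurable_EFinP.
have mf := @continuous_measurable_fun R f cf.
apply: measurable_funM => //; apply: measurable_funB => //.
apply: measurableT_comp => //.
exact: measurable_funD.
Qed.

Lemma upper_derivativeE (f : R -> R) x : derivable f x 1 ->
  upper_derivative f x = derive1 f x.
Proof.
move=> df; rewrite /upper_derivative derive1E.
suff H : ((f (x + k.+1%:R^-1) - f x) * k.+1%:R)%:E @[k --> \oo] --> ('D_1 f x)%:E.
  by rewrite is_cvg_limn_esupE ?(cvg_lim _ H)//; apply/cvg_ex; eexists; exact: H.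
apply/fine_cvgP; split; first exact: nearW.
have /cvgr_dnbhsP := df.
move=> /(_ (fun k => k.+1%:R^-1)) /=.
rewrite [fine \o _](_ : _ =
    (fun k => k.+1%:R^-1^-1 *: (f (k.+1%:R^-1 *: 1 + x) - f x))).
  by apply; split => [n|]; [rewrite invr_eq0 pnatr_eq0|exact: cvg_harmonic].
by apply/funext => k /=; rewrite invrK [_ *: 1]mulr1 mulrC addrC addrC (addrC x).
Qed.

(** Lebesgue's differentiation theorem applied to [h]; [f] differs from the
    primitive of [h] by a constant. *)
Lemma locally_ac_derivable (f : R -> R) a b h : 
  mu.-integrable setT (EFin \o h) -> density_on a b f h ->
  {ae mu, forall x, a < x < b -> derivable f x 1 /\ derive1 f x = h x}.
Proof.
move=> ih H.
pose F (z : R) := (\int[mu]_(t in [set` Interval (BRight a) (BRight z)]) h t)%R.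
have ih' y : mu.-integrable [set` Interval (BRight a) (BRight y)] (EFin \o h).
  apply: (integrableS measurableT) => //; exact: measurable_itv.
have lh : locally_integrable [set: R] h.
  by apply: open_integrable_locally => //; exact: openT.
have := FTC1 ih' lh.
apply: ae_mono => x Fx /andP[ax xb].
have {}Fx : derivable F x 1 /\ derive1 F x = h x by apply: Fx; rewrite /= lte_fin.
have near_fF : \forall z \near x, F z + f a = f z.
  have : \forall z \near x, z \in `]a, b[ by apply: near_in_itvoo; rewrite in_itv/= ax.
  apply: filterS => z; rewrite in_itv/= => /andP[az zb].
  rewrite /F /Rintegral H//; [|exact: ltW..].
  by rewrite /=; lra.
have : is_derive x 1 f (h x).
  apply: near_eq_is_derive near_fF _.
  rewrite -[h x]addr0 -Fx.2 derive1E.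
  apply: is_deriveD.
  by apply: DeriveDef; [exact: Fx.1|].
by move=> [? <-]; rewrite derive1E.
Unshelve. all: by end_near. Qed.

(** The densities on the intervals [[- n, n]] all coincide almost everywhere
    with the derivative, so they glue to one density on the line. *)
Lemma locally_ac_derivative (f : R -> R) : locally_ac f ->
  exists D : R -> R, [/\ measurable_fun [set: R] D,
    {ae mu, forall x, derive1 f x = D x} &
    forall x y, x <= y -> mu.-integrable `[x, y] (EFin \o D) /\
      (\int[mu]_(t in `[x, y[) (D t)%:E)%E = (f y - f x)%:E].
Proof.
move=> fac; exists (upper_derivative f).
have mD := measurable_upper_derivative (locally_ac_continuous fac).
have /choice[h hP] : forall n : nat, exists h : R -> R, 
    mu.-integrable setT (EFin \o h) /\ density_on (- n%:R) n%:R f h.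
  by move=> n; have [h ? ?] := locally_ac_density_on (- n%:R) n%:R fac; exists h.
have aeh : {ae mu, forall x, forall n : nat, - n%:R < x < n%:R ->
    derivable f x 1 /\ derive1 f x = h n x}.
  by apply: ae_foralln => n; have [h1 h2] := hP n; exact: locally_ac_derivable.
split => //.
  apply: ae_mono aeh => x /(_ (Num.bound `|x|)) [|dfx _].
    by rewrite -ltr_norml archi_boundP.
  by rewrite upper_derivativeE.
move=> x y xy.
(* on the interval from [- n] to [n], which contains [x] and [y], the density
   [h n] is the derivative almost everywhere *)
pose n := Num.bound (`|x| + `|y|).
have n_gt : `|x| + `|y| < n%:R by rewrite archi_boundP// addr_ge0.
have /andP[nx _] : - n%:R < x < n%:R.
  by rewrite -ltr_norml (le_lt_trans _ n_gt)// lerDl.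
have /andP[_ ny] : - n%:R < y < n%:R.
  by rewrite -ltr_norml (le_lt_trans _ n_gt)// lerDr.
have [ihn Hn] := hP n.
have aeD : ae_eq mu `[x, y]%classic (EFin \o h n) (EFin \o upper_derivative f).
  apply: ae_mono aeh => z /(_ n) + /= ; rewrite in_itv/= => + /andP[xz zy].
  rewrite (lt_le_trans nx xz) (le_lt_trans zy ny) => /(_ isT)[dz <-].
  by rewrite upper_derivativeE.
have mxy : measurable (`[x, y]%classic : set (measurableTypeR R)).
  exact: measurable_itv.
have mED : measurable_fun (`[x, y]%classic : set (measurableTypeR R))
    (EFin \o upper_derivative f).
  by apply: measurable_funTS; apply/measurable_EFinP.
have mEh : measurable_fun (`[x, y]%classic : set (measurableTypeR R))
    (EFin \o h n).
  by apply: measurable_funTS; exact: measurable_int ihn.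
split.
  apply: ae_eq_integrable aeD _ => //.
  by apply: (integrableS measurableT).
rewrite -(Hn x y (ltW nx) xy (ltW ny)).
have moo (k : R -> \bar R) :
    measurable_fun (`[x, y]%classic : set (measurableTypeR R)) k ->
    measurable_fun (`]x, y[%classic : set (measurableTypeR R)) k.
  by apply: measurable_funS => //; exact: subset_itv_oo_cc.
transitivity (\int[mu]_(t in `[x, y]) (upper_derivative f t)%:E)%E.
  rewrite (integral_itv_bndoo _ _ (moo _ mED)).
  by rewrite -(integral_itv_bndoo true false (moo _ mED)).
transitivity (\int[mu]_(t in `[x, y]) (h n t)%:E)%E.
  apply: ae_eq_integral => //.
  by apply: ae_mono aeD => z hz /hz.
rewrite (integral_itv_bndoo _ _ (moo _ mEh)).
by rewrite -(integral_itv_bndoo false false (moo _ mEh)).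
Qed.

End derivative_density.

(** * Product measures *)

Section products.
Context d1 d2 (T1 : measurableType d1) (T2 : measurableType d2) (R : realType).
Variables (m1 : {sigma_finite_measure set T1 -> \bar R})
          (m2 : {sigma_finite_measure set T2 -> \bar R}).

Lemma integral_prod_mul (f : T1 -> R) (g : T2 -> R) :
  m1.-integrable setT (EFin \o f) -> m2.-integrable setT (EFin \o g) ->
  (\int[m1 \x m2]_z (f z.1 * g z.2)%:E)%E =
  (\int[m1]_x (f x)%:E * \int[m2]_y (g y)%:E)%E.
Proof.
move=> intf intg.
have mf : measurable_fun setT f by apply/measurable_EFinP; exact: measurable_int intf.
have mg : measurable_fun setT g by apply/measurable_EFinP; exact: measurable_int intg.
have mfg : measurable_fun [set: T1 * T2] (fun z => (f z.1 * g z.2)%:E).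
  apply/measurable_EFinP; apply: measurable_funM.
    exact: measurableT_comp mf measurable_fst.
  exact: measurableT_comp mg measurable_snd.
have inner (x : T1) : (\int[m2]_y (f x * g y)%:E = (f x)%:E * \int[m2]_y (g y)%:E)%E.
  by rewrite -integralZl.
have gfin : (\int[m2]_y (g y)%:E)%E \is a fin_num by exact: integrable_fin_num.
have intfg : (m1 \x m2)%E.-integrable setT (fun z => (f z.1 * g z.2)%:E).
  apply/integrable12ltyP => //.
  have absfin : (\int[m2]_y `|(g y)%:E|)%E \is a fin_num.
    by apply: integrable_fin_num => //; exact: integrable_abse.
  under eq_integral.
    move=> x _; under eq_integral do rewrite /= normrM EFinM.
    rewrite integralZl//; last exact: (integrable_abse intg).
    over.
  rewrite -(fineK absfin) integralZr//; last exact: (integrable_abse intf).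
  have fabsfin : (\int[m1]_x `|(f x)%:E|)%E \is a fin_num.
    by apply: integrable_fin_num => //; exact: integrable_abse.
  by rewrite -(fineK fabsfin) -EFinM ltry.
rewrite -(integral12_prod_meas1 intfg).
rewrite /fubini_F; under eq_integral do rewrite inner.
by rewrite -(fineK gfin) integralZr.
Qed.

Lemma integrable_fubini_G (f : T1 * T2 -> \bar R) :
  (m1 \x m2)%E.-integrable setT f -> m2.-integrable setT (fubini_G m1 f).
Proof.
move=> intf; have mf := measurable_int _ intf.
apply/integrableP; split; first exact: measurable_fubini_G intf.
have /integrable21ltyP := intf => /(_ mf); apply: le_lt_trans.
have mabs : measurable_fun setT (abse \o f) by exact: measurableT_comp.
apply: ge0_le_integral => //.
- by apply: measurableT_comp => //; exact: measurable_fubini_G intf.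
- exact: measurable_fun_fubini_tonelli_G mabs (fun=> abse_ge0 _).
- move=> y _; apply: le_abse_integral => //.
  exact: measurable_fun_pair1 mf.
Qed.

End products.

Section swap.
Context d (T : measurableType d) (R : realType).
Variable m : {sigma_finite_measure set T -> \bar R}.

Lemma integrable_swap (f : T * T -> \bar R) :
  (m \x m)%E.-integrable setT f ->
  (m \x m)%E.-integrable setT (fun z => f (z.2, z.1)).
Proof.
move=> intf; have mf := measurable_int _ intf.
apply/integrable21ltyP; first apply: (measurableT_comp mf).
  exact: measurable_fun_pair measurable_snd measurable_fst.
by have /integrable12ltyP := intf; exact.
Qed.

Lemma integral_swap (f : T * T -> \bar R) :
  (m \x m)%E.-integrable setT f ->
  (\int[m \x m]_z f (z.2, z.1) = \int[m \x m]_z f z)%E.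
Proof.
move=> intf; have intfs := integrable_swap intf.
rewrite -(integral12_prod_meas1 intf).
by rewrite -(integral21_prod_meas1 intfs).
Qed.

End swap.

(** * Hoeffding's covariance formula on the line *)

Lemma measurable_natr_bool d (T : measurableType d) (R : realType) (b : T -> bool) :
  measurable_fun setT b -> measurable_fun setT (fun x => (b x)%:R : R).
Proof.
move=> mb; rewrite (_ : (fun _ => _) = \1_(b @^-1` [set true])).
  by apply: measurable_indic; rewrite -[X in measurable X]setTI; exact: mb.
apply/funext => x; rewrite indicE; congr ((nat_of_bool _)%:R).
by apply/idP/idP; rewrite inE /=; [move=> ->|case: (b x)].
Qed.

Section covariance_kernel.
Context {R : realType} (m : probability R R).
Let mm : probability (R * R)%type R := (m \x m)%E.

(** The indicator of the pairs whose interval [[p.2, p.1[] contains [s]. It is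
    the derivative kernel of an increment: [K p.1 - K p.2] is the integral of
    [K' s * between s p]. *)
Definition between (s : R) (p : R * R) : R := ((p.2 <= s) && (s < p.1))%:R.

Lemma between_mulE s t p : between s p * between t p =
  \1_(`]Num.max s t, +oo[ `*` `]-oo, Num.min s t]) p.
Proof.
rewrite /between -natrM mulnb indicE; congr ((nat_of_bool _)%:R).
apply/idP/idP.
  move=> /andP[/andP[h1 h2] /andP[h3 h4]]; rewrite inE; split => /=.
    by rewrite in_itv/= gt_max h2 h4.
  by rewrite in_itv/= le_min h1 h3.
rewrite inE => -[] /=; rewrite !in_itv/= andbT gt_max le_min.
by move=> /andP[-> ->] /andP[-> ->].
Qed.

(** The kernel is the probability that two independent points separate both [s]
    and [t]. This explains its sign and makes it a mixture of products. *)
Lemma covariance_kernelE s t :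
  (mm (`]Num.max s t, +oo[ `*` `]-oo, Num.min s t]) = (covariance_kernel m s t)%:E)%E.
Proof.
have mE : mm (`]Num.max s t, +oo[ `*` `]-oo, Num.min s t]) =
    (m `]Num.max s t, +oo[%classic * m `]-oo, Num.min s t]%classic)%E.
  by apply: product_measure1E; exact: measurable_itv.
rewrite mE.
have FE u : m `]-oo, u]%classic = (distribution_function m u)%:E.
  by rewrite /distribution_function fineK// fin_num_measure//; exact: measurable_itv.
rewrite -setCitvl probability_setC; last exact: measurable_itv.
rewrite !FE /covariance_kernel -EFinB -EFinM; congr (_%:E).
by case: (leP s t) => st; lra.
Qed.

Lemma covariance_kernel_ge0 s t : 0 <= covariance_kernel m s t.
Proof. by rewrite -lee_fin -covariance_kernelE. Qed.

Lemma integral_between_mul s t :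
  (\int[mm]_p (between s p * between t p)%:E = (covariance_kernel m s t)%:E)%E.
Proof.
under eq_integral do rewrite between_mulE.
have mB : measurable (`]Num.max s t, +oo[%classic `*` `]-oo, Num.min s t]%classic).
  by apply: measurableX; exact: measurable_itv.
by rewrite integral_indic// setIT; exact: covariance_kernelE.
Qed.

End covariance_kernel.

Section lebesgue_square.
Context {R : realType}.
Notation T := (measurableTypeR R).
Notation mu := (@lebesgue_measure R).

(** The Lebesgue measure on the plane as an object of its own, on which a
    structure of sigma-finite measure can be inferred. *)
Definition lebesgue_square : set (T * T)%type -> \bar R := (mu \x mu)%E.

HB.instance Definition _ := Measure.on lebesgue_square.

Lemma sigma_finite_lebesgue_square : sigma_finite [set: T * T] lebesgue_square.
Proof.
pose I n : set T := `]- n%:R, n%:R[%classic.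
have mI n : measurable (I n) by exact: measurable_itv.
exists (fun n => I n `*` I n).
  apply/seteqP; split => // -[x y] _; exists (Num.bound (`|x| + `|y|)) => //.
  have n_gt : `|x| + `|y| < (Num.bound (`|x| + `|y|))%:R.
    by rewrite archi_boundP// addr_ge0.
  by split; rewrite /I /mkset /= in_itv/= -ltr_norml;
    rewrite (le_lt_trans _ n_gt)// (lerDl, lerDr).
move=> n; split; first exact: measurableX.
rewrite /lebesgue_square product_measure1E//.
have Ifin : (mu (I n) < +oo)%E.
  have -> : mu (I n) = _ := lebesgue_measure_itv _.
  by case: ifP => _ //; rewrite -EFinB ltry.
by rewrite lte_mul_pinfty// ge0_fin_numE.
Qed.

HB.instance Definition _ := Measure_isSigmaFinite.Build _ _ _ lebesgue_square
  sigma_finite_lebesgue_square.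

End lebesgue_square.

Section hoeffding.
Context {R : realType} (m : probability R R).
Notation mu := (@lebesgue_measure R).
Notation T := (measurableTypeR R).
Let mm : probability (R * R)%type R := (m \x m)%E.
Notation ll := (@lebesgue_square R).
Variables (phi psi D E : R -> R).
Hypothesis mD : measurable_fun [set: R] D.
Hypothesis mE : measurable_fun [set: R] E.
Hypothesis phiD : forall x y, x <= y -> mu.-integrable `[x, y] (EFin \o D) /\
      (\int[mu]_(t in `[x, y[) (D t)%:E)%E = (phi y - phi x)%:E.
Hypothesis psiE : forall x y, x <= y -> mu.-integrable `[x, y] (EFin \o E) /\
      (\int[mu]_(t in `[x, y[) (E t)%:E)%E = (psi y - psi x)%:E.

Let integrand (z : (T * T) * (R * R)) : R :=
  (D z.1.1 * between z.1.1 z.2) * (E z.1.2 * between z.1.2 z.2).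

Let measurable_between_comp d (S : measurableType d) (f : S -> R) (p : S -> R * R) :
  measurable_fun setT f -> measurable_fun setT p ->
  measurable_fun setT (fun z => between (f z) (p z)).
Proof.
move=> mf mp; apply: measurable_natr_bool; apply: measurable_and.
  apply: measurable_fun_ler => //; exact: measurableT_comp measurable_snd mp.
apply: measurable_fun_ltr => //; exact: measurableT_comp measurable_fst mp.
Qed.

Let measurable_integrand : measurable_fun setT integrand.
Proof.
have m11 : measurable_fun [set: (T * T) * (R * R)] (fun z => z.1.1 : R).
  exact: (measurableT_comp measurable_fst measurable_fst).
have m12 : measurable_fun [set: (T * T) * (R * R)] (fun z => z.1.2 : R).
  exact: (measurableT_comp measurable_snd measurable_fst).
have m2 : measurable_fun [set: (T * T) * (R * R)] (fun z => z.2 : R * R).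
  exact: measurable_snd.
apply: measurable_funM; apply: measurable_funM.
- exact: (measurableT_comp mD m11).
- exact: measurable_between_comp.
- exact: (measurableT_comp mE m12).
- exact: measurable_between_comp.
Qed.

Let integral_between (k K : R -> R) (p : R * R) :
  measurable_fun [set: R] k ->
  (forall x y, x <= y -> mu.-integrable `[x, y] (EFin \o k) /\
      (\int[mu]_(t in `[x, y[) (k t)%:E)%E = (K y - K x)%:E) ->
  mu.-integrable setT (fun t => (k t * between t p)%:E) /\
  (\int[mu]_t (k t * between t p)%:E = ((p.2 < p.1)%R%:R * (K p.1 - K p.2))%:E)%E.
Proof.
move=> mk kK.
have mitv : measurable (`[p.2, p.1[%classic : set T) by exact: measurable_itv.
have -> : (fun t => (k t * between t p)%:E) =
          ((EFin \o k) \_ (`[p.2, p.1[%classic : set T)).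
  apply/funext => t; rewrite patchE /between.
  have [|] := boolP (t \in (`[p.2, p.1[%classic : set T)).
    by rewrite inE/= in_itv/= => ->; rewrite mulr1.
  by rewrite notin_setE/= in_itv/= => /negP/negbTE ->; rewrite mulr0.
rewrite -integral_mkcond; have [xy|yx] := ltP p.2 p.1; last first.
  rewrite set_itv_ge ?bnd_simp -?leNgt// patch_set0 integral_set0 mul0r; split => //.
  exact: integrable0.
have [ik ->] := kK _ _ (ltW xy); rewrite mul1r; split => //.
apply/(integrable_mkcond _ mitv).
apply: (@integrableS _ _ _ mu `[p.2, p.1]%classic) ik => //.
exact: subset_itv_co_cc.
Qed.

(** Both sides are iterated integrals of [integrand]: integrating over [p] first
    gives the kernel, integrating over [(s, t)] first gives the increments.
    Since the kernel is nonnegative, the absolute value of [integrand] has the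
    absolute value of the left-hand integrand as its integral over [p]. *)
Lemma hoeffding_half :
  ll.-integrable setT
    (fun st => (D st.1 * covariance_kernel m st.1 st.2 * E st.2)%:E) ->
  (\int[ll]_st (D st.1 * covariance_kernel m st.1 st.2 * E st.2)%:E =
   \int[mm]_p ((p.2 < p.1)%R%:R * ((phi p.1 - phi p.2) * (psi p.1 - psi p.2)))%:E)%E.
Proof.
move=> intk.
have intbb s t : mm.-integrable setT (fun p => (between s p * between t p)%:E).
  apply/integrableP; split.
    apply/measurable_EFinP; apply: measurable_funM; exact: measurable_between_comp.
  under eq_integral do rewrite gee0_abs ?lee_fin ?mulr_ge0//.
  by rewrite integral_between_mul ltry.
have inner st : (\int[mm]_p (integrand (st, p))%:E =
    (D st.1 * covariance_kernel m st.1 st.2 * E st.2)%:E)%E.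
  under eq_integral do rewrite /integrand/= mulrACA EFinM.
  have := integralZl measurableT (intbb st.1 st.2) (D st.1 * E st.2) => /= ->.
  by rewrite integral_between_mul -EFinM mulrAC.
have innerabs st : (\int[mm]_p `|(integrand (st, p))%:E| =
    `|(D st.1 * covariance_kernel m st.1 st.2 * E st.2)%:E|)%E.
  under eq_integral.
    move=> p _; rewrite /integrand/= mulrACA normrM.
    rewrite (@ger0_norm _ (between _ _ * _)) ?mulr_ge0// EFinM; over.
  have := integralZl measurableT (intbb st.1 st.2) `|D st.1 * E st.2| => /= ->.
  rewrite integral_between_mul -EFinM/= [D _ * _ * _]mulrAC [in RHS]normrM.
  by rewrite (ger0_norm (covariance_kernel_ge0 _ _ _)).
have intG : (ll \x mm)%E.-integrable setT (EFin \o integrand).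
  apply/integrable12ltyP; first exact/measurable_EFinP.
  under eq_integral do rewrite innerabs.
  by move/integrableP : intk => [].
under eq_integral do rewrite -inner.
rewrite (Fubini intG); apply: eq_integral => p _.
have [iD eD] := integral_between p mD phiD.
have [iE eE] := integral_between p mE psiE.
rewrite (integral_prod_mul iD iE) eD eE -EFinM; congr (_%:E).
by case: (p.2 < p.1); rewrite ?mul1r ?mul0r.
Qed.

End hoeffding.

Section hoeffding.
Context {R : realType} (m : probability R R).
Notation mu := (@lebesgue_measure R).
Notation T := (measurableTypeR R).
Let mm : probability (R * R)%type R := (m \x m)%E.
Notation ll := (@lebesgue_square R).

(** Fold the plane along the diagonal, where the integrand vanishes: the
    contributions of [(x, x')] and [(x', x)] add up to the product of the
    increments. *)
Lemma integral_half (phi psi : R -> R) :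
  mm.-integrable setT (fun p => (phi p.1 * (psi p.1 - psi p.2))%:E) ->
  (\int[mm]_p (phi p.1 * (psi p.1 - psi p.2))%:E =
  \int[mm]_p ((p.2 < p.1)%R%:R * ((phi p.1 - phi p.2) * (psi p.1 - psi p.2)))%:E)%E.
Proof.
pose H (p : R * R) := phi p.1 * (psi p.1 - psi p.2) => iH.
have ipart (b : R * R -> bool) : measurable_fun setT b ->
    mm.-integrable setT (fun p => ((b p)%:R * H p)%:E).
  move=> mb.
  have mbR : measurable_fun setT (fun p => (b p)%:R : R).
    exact: measurable_natr_bool.
  have mH : measurable_fun setT H by apply/measurable_EFinP; exact: measurable_int iH.
  apply: (le_integrable measurableT _ _ iH).
    by apply/measurable_EFinP; exact: measurable_funM.
  by move=> p _; rewrite /= lee_fin normrM normr_nat; case: (b p); rewrite ?mul1r ?mul0r.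
have i1 : mm.-integrable setT (fun p => ((p.2 < p.1)%R%:R * H p)%:E).
  by apply: ipart; exact: measurable_fun_ltr measurable_snd measurable_fst.
have i2 : mm.-integrable setT (fun p => ((p.1 < p.2)%R%:R * H p)%:E).
  by apply: ipart; exact: measurable_fun_ltr measurable_fst measurable_snd.
have i2s := integrable_swap i2.
transitivity (\int[mm]_p (((p.2 < p.1)%R%:R * H p)%:E + ((p.1 < p.2)%R%:R * H p)%:E))%E.
  apply: eq_integral => p _; rewrite -EFinD -mulrDl -natrD; congr (_%:E).
  have [| |] := ltgtP p.1 p.2; rewrite ?mul1r// => p12.
  by rewrite /H p12 subrr !mulr0.
rewrite integralD// -(integral_swap i2).
rewrite -integralD//=; apply: eq_integral => p _.
rewrite -EFinD -mulrDr; congr (_%:E); congr (_ * _).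
by rewrite /H/=; lra.
Qed.

(** Measurability comes for free from the kernel being an integral of a
    jointly measurable function. *)
Lemma measurable_covariance_kernel :
  measurable_fun [set: R * R] (fun st => covariance_kernel m st.1 st.2).
Proof.
pose f (z : (R * R) * (R * R)) := (between z.1.1 z.2 * between z.1.2 z.2)%:E.
have mb (s : (R * R) * (R * R) -> R) : measurable_fun setT s ->
    measurable_fun setT (fun z : (R * R) * (R * R) => between (s z) z.2).
  move=> ms; apply: measurable_natr_bool; apply: measurable_and.
    apply: measurable_fun_ler => //; exact: measurableT_comp measurable_snd measurable_snd.
  apply: measurable_fun_ltr => //; exact: measurableT_comp measurable_fst measurable_snd.
have mf : measurable_fun setT f.
  apply/measurable_EFinP; apply: measurable_funM; apply: mb.
    exact: (measurableT_comp measurable_fst measurable_fst).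
  exact: (measurableT_comp measurable_snd measurable_fst).
apply/measurable_EFinP; rewrite (_ : _ \o _ = fubini_F mm f).
  by apply: measurable_fun_fubini_tonelli_F => // z; rewrite lee_fin mulr_ge0.
by apply/funext => -[s t]; rewrite /fubini_F /f/= integral_between_mul.
Qed.

(** The derivatives are replaced by measurable versions of them, to which the
    half-plane formula applies. *)
Lemma hoeffding_formula (phi psi : R -> R) :
  locally_ac phi -> locally_ac psi ->
  mm.-integrable setT (fun p => (phi p.1 * (psi p.1 - psi p.2))%:E) ->
  ll.-integrable setT (fun st =>
    (derive1 phi st.1 * covariance_kernel m st.1 st.2 * derive1 psi st.2)%:E) ->
  (\int[mm]_p (phi p.1 * (psi p.1 - psi p.2))%:E =
   \int[ll]_st (derive1 phi st.1 * covariance_kernel m st.1 st.2 *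
     derive1 psi st.2)%:E)%E.
Proof.
move=> phi_ac psi_ac i1 i2.
have [D [mD aeD phiD]] := locally_ac_derivative phi_ac.
have [E [mE aeE psiE]] := locally_ac_derivative psi_ac.
rewrite integral_half//.
have aeDE : ae_eq ll setT
    (fun st => (derive1 phi st.1 * covariance_kernel m st.1 st.2 *
      derive1 psi st.2)%:E)
    (fun st => (D st.1 * covariance_kernel m st.1 st.2 * E st.2)%:E).
  have h1 : {ae ll, forall st, derive1 phi st.1 = D st.1} by exact: ae_prod1 aeD.
  have h2 : {ae ll, forall st, derive1 psi st.2 = E st.2} by exact: ae_prod2 aeE.
  by apply: ae_mono2 h1 h2 => st -> ->.
have mDE : measurable_fun [set: T * T]
    (fun st => (D st.1 * covariance_kernel m st.1 st.2 * E st.2)%:E).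
  apply/measurable_EFinP; apply: measurable_funM; first apply: measurable_funM.
  - exact: (measurableT_comp mD measurable_fst).
  - exact: measurable_covariance_kernel.
  - exact: (measurableT_comp mE measurable_snd).
transitivity (\int[ll]_st (D st.1 * covariance_kernel m st.1 st.2 * E st.2)%:E)%E;
  last first.
  apply/esym; apply: ae_eq_integral => //; exact: measurable_int i2.
rewrite (hoeffding_half mD mE phiD psiE)//.
exact: ae_eq_integrable mDE aeDE i2.
Qed.

End hoeffding.

(** * Image measures and boxes *)

Definition has_law d1 d2 (X : measurableType d1) (Y : measurableType d2)
    (R : realType) (m1 : set X -> \bar R) (phi : X -> Y) (m2 : set Y -> \bar R) :=
  measurable_fun setT phi /\
  forall A, measurable A -> m1 (phi @^-1` A) = m2 A.

Section law.
Context d1 d2 (X : measurableType d1) (Y : measurableType d2) (R : realType).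
Variables (m1 : {measure set X -> \bar R}) (m2 : {measure set Y -> \bar R}).
Variable phi : X -> Y.
Hypothesis law : has_law m1 phi m2.

Let mphi : measurable_fun setT phi := law.1.

Lemma law_ge0_integral (f : Y -> \bar R) : measurable_fun setT f ->
  (forall y, (0 <= f y)%E) -> (\int[m1]_x f (phi x) = \int[m2]_y f y)%E.
Proof.
move=> mf f0.
have := @ge0_integral_pushforward _ _ _ _ _ _ mphi m1 setT f measurableT mf
  (fun y _ => f0 y).
rewrite preimage_setT => /= <-.
by apply: eq_measure_integral => // A mA _; exact: law.2.
Qed.

Lemma law_integrable (f : Y -> \bar R) : m2.-integrable setT f ->
  m1.-integrable setT (f \o phi).
Proof.
move=> /integrableP[mf foo]; apply/integrableP; split.
  exact: measurableT_comp mf mphi.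
rewrite (law_ge0_integral (f := fun y => `|f y|%E))//.
exact: measurableT_comp.
Qed.

Lemma law_integral (f : Y -> \bar R) : m2.-integrable setT f ->
  (\int[m1]_x f (phi x) = \int[m2]_y f y)%E.
Proof.
move=> intf.
have := @integral_pushforward _ _ _ _ _ _ mphi m1 setT f (measurable_int _ intf).
rewrite preimage_setT => /(_ (law_integrable intf) measurableT) /= <-.
by apply: eq_measure_integral => // A mA _; exact: law.2.
Qed.

End law.

Section boxes.
Context {R : realType} (n : nat).

Definition box (A : 'I_n -> set R) : set (n.-tuple R) :=
  [set x | forall i, A i (tnth x i)].

Lemma measurable_box A : (forall i, measurable (A i)) -> measurable (box A).
Proof.
move=> mA; rewrite (_ : box A = \bigcap_(j in [set: 'I_n]) (@tnth n R ^~ j @^-1` A j)).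
  apply: fin_bigcap_measurable => // j _; rewrite -[X in measurable X]setTI.
  exact: measurable_tnth.
by apply/seteqP; split => y/= Ay j; [move=> _|]; exact: Ay.
Qed.

Lemma measure_unique_box (m1 m2 : probability (n.-tuple R) R) :
  (forall A, (forall i, measurable (A i)) -> m1 (box A) = m2 (box A)) ->
  forall B, measurable B -> m1 B = m2 B.
Proof.
move=> m12 B mB.
pose G : set (set (n.-tuple R)) :=
  [set C | exists2 A : 'I_n -> set R, forall i, measurable (A i) & C = box A].
have GT : G setT.
  by exists (fun=> setT) => //; apply/seteqP; split.
apply: (measure_unique G (fun=> setT)) => //.
- apply/seteqP; split.
    apply: smallest_sub; first exact: smallest_sigma_algebra.
    move=> C; rewrite -bigcup_seq/= => -[i _ [A mA <-]].
    apply: sub_sigma_algebra.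
    exists (fun j => if j == i then A else setT).
      by move=> j; case: ifP.
    apply/seteqP; split => x /= => [[_ h] j|h]; first by case: eqP => // ->.
    by split => //; have := h i; rewrite eqxx.
  apply: smallest_sub; first exact: sigma_algebra_measurable.
  by move=> _ [A mA ->]; exact: measurable_box.
- move=> _ _ [A mA ->] [A' mA' ->]; exists (fun i => A i `&` A' i).
    by move=> i; exact: measurableI.
  by apply/seteqP; split => x /= => [[h1 h2] i|h]; [split|split => i; case: (h i)].
- by apply/seteqP; split => // x _; exists 0%N.
- by move=> _ [A mA ->]; exact: m12.
- by move=> _; rewrite (le_lt_trans (probability_le1 _ _))// ltry.
Qed.

End boxes.

Section insertion.
Context {R : realType} (d : nat) (m : 'I_d -> probability R R) (i : 'I_d).
Notation P := (product_probability_except m i).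

Lemma tnth_insert_coord t (y : d.-1.-tuple R) : tnth (insert_coord i t y) i = t.
Proof. by rewrite tnth_mktuple unlift_none. Qed.

Lemma tnth_insert_coord_lift t (y : d.-1.-tuple R) j :
  tnth (insert_coord i t y) (lift i j) = tnth y j.
Proof. by rewrite tnth_mktuple liftK. Qed.

Lemma measurable_insert_coord :
  measurable_fun setT (fun p : R * d.-1.-tuple R => insert_coord i p.1 p.2).
Proof.
apply/measurable_fun_tnthP => j.
case: (unliftP i j) => [k|] ->.
  rewrite (_ : _ \o _ = fun p : R * d.-1.-tuple R => tnth p.2 k).
    exact: (measurableT_comp (measurable_tnth k) measurable_snd).
  by apply/funext => p /=; rewrite tnth_insert_coord_lift.
rewrite (_ : _ \o _ = fst) //.
by apply/funext => p /=; rewrite tnth_insert_coord.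
Qed.

Lemma insert_coord_law :
  has_law (m i \x P)%E (fun p : R * d.-1.-tuple R => insert_coord i p.1 p.2)
    (product_probability m).
Proof.
split; first exact: measurable_insert_coord.
move=> A mA; pose q : probability _ R :=
  distribution (m i \x P)%E (mfun_Sub (mem_set measurable_insert_coord)).
rewrite -[LHS]/(q A); apply: measure_unique_box mA => {}A mA.
rewrite /q/= /distribution /pushforward/=.
rewrite (_ : _ @^-1` _ = A i `*` box (fun j => A (lift i j))); last first.
  apply/seteqP; split => -[t y] /=.
    move=> h; split; first by have := h i; rewrite tnth_insert_coord.
    by move=> j; have := h (lift i j); rewrite tnth_insert_coord_lift.
  move=> [/= At h] j; case: (unliftP i j) => [k|] ->.
    by rewrite tnth_insert_coord_lift; exact: h.
  by rewrite tnth_insert_coord.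
rewrite product_measure1E//; last by apply: measurable_box.
rewrite /product_probability_except /box !product_probabilityE//.
by rewrite [RHS](bigD1_ord i)//; congr (_ * _)%E; apply: product_probabilityE.
Qed.

End insertion.

(** * Laws of spliced points *)

Section splicing.
Context {R : realType} (d : nat) (m : 'I_d -> probability R R).
Notation mu := (product_probability m).

(** Unlike in [splice], the cut [k] may also be [d], so that the sequence runs
    from [x'] to [x]. *)
Definition splice_at (k : nat) (x x' : d.-tuple R) : d.-tuple R :=
  [tuple if (j < k)%N then tnth x j else tnth x' j | j < d].

Lemma splice_at0 x x' : splice_at 0 x x' = x'.
Proof. by apply: eq_from_tnth => j; rewrite tnth_mktuple. Qed.

Lemma splice_at_full x x' : splice_at d x x' = x.
Proof. by apply: eq_from_tnth => j; rewrite tnth_mktuple ltn_ord. Qed.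

Lemma measurable_splice_at k : measurable_fun setT
  (fun p : d.-tuple R * d.-tuple R => splice_at k p.1 p.2).
Proof.
apply/measurable_fun_tnthP => j.
rewrite (_ : _ \o _ = fun p : d.-tuple R * d.-tuple R =>
    if (j < k)%N then tnth p.1 j else tnth p.2 j); last first.
  by apply/funext => p /=; rewrite tnth_mktuple.
by case: (j < k)%N;
  [exact: (measurableT_comp (measurable_tnth j) measurable_fst)
  |exact: (measurableT_comp (measurable_tnth j) measurable_snd)].
Qed.

(** Each coordinate is taken from one of two independent points with the same
    marginal. *)
Lemma splice_at_law k :
  has_law (mu \x mu)%E (fun p => splice_at k p.1 p.2) mu.
Proof.
split; first exact: measurable_splice_at.
move=> B mB; pose q : probability _ R :=
  distribution (mu \x mu)%E (mfun_Sub (mem_set (measurable_splice_at k))).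
rewrite -[LHS]/(q B); apply: measure_unique_box mB => {B} A mA.
rewrite /q/= /distribution /pushforward/=.
rewrite (_ : _ @^-1` _ = box (fun j => if (j < k)%N then A j else setT) `*`
    box (fun j => if (j < k)%N then setT else A j)); last first.
  apply/seteqP; split => -[x x'] /=.
    move=> h; split => j; have := h j; rewrite tnth_mktuple /=;
    by case: (j < k)%N.
  move=> [h h'] j; have := h j; have := h' j; rewrite tnth_mktuple /=.
  by case: (j < k)%N.
have m1 (j : 'I_d) : measurable (if (j < k)%N then A j else setT) by case: ifP.
have m2 (j : 'I_d) : measurable (if (j < k)%N then setT else A j) by case: ifP.
rewrite product_measure1E//; [|exact: measurable_box..].
transitivity ((\prod_(j < d) m j (if (j < k)%N then A j else setT)) *
    (\prod_(j < d) m j (if (j < k)%N then setT else A j)))%E.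
  by congr (_ * _)%E; exact: product_probabilityE.
rewrite -[LHS]big_split/= [RHS]product_probabilityE//.
by apply: eq_bigr => j _; case: ifP => _; rewrite probability_setT ?mule1 ?mul1e.
Qed.

End splicing.

Section pair_insertion.
Context {R : realType} (d : nat) (m : 'I_d -> probability R R) (i : 'I_d).
Notation mu := (product_probability m).
Let P := product_probability_except m i.
Let PP := product_probability_except2 m i.
Let mm : probability (R * R)%type R := (m i \x m i)%E.
Notation Y := (d.-1.-tuple R).

Definition insert_pair (z : (R * R) * (Y * Y)) : d.-tuple R * d.-tuple R :=
  (insert_coord i z.1.1 z.2.1, insert_coord i z.1.2 z.2.2).

Lemma measurable_insert_pair : measurable_fun setT insert_pair.
Proof.
apply: measurable_fun_pair.
  apply: (measurableT_comp (measurable_insert_coord i)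
    (g := fun z : (R * R) * (Y * Y) => (z.1.1, z.2.1))).
  apply: measurable_fun_pair.
    exact: (measurableT_comp measurable_fst measurable_fst).
  exact: (measurableT_comp measurable_fst measurable_snd).
apply: (measurableT_comp (measurable_insert_coord i)
  (g := fun z : (R * R) * (Y * Y) => (z.1.2, z.2.2))).
apply: measurable_fun_pair.
  exact: (measurableT_comp measurable_snd measurable_fst).
exact: (measurableT_comp measurable_snd measurable_snd).
Qed.

Let section_mass (A : set (d.-tuple R)) (y : Y) : R :=
  fine (\int[m i]_s (\1_A (insert_coord i s y))%:E).

Let mindic A : measurable A -> measurable_fun setT
  (fun p : R * Y => \1_A (insert_coord i p.1 p.2) : R).
Proof.
move=> mA; apply: measurableT_comp (measurable_insert_coord i).
exact: measurable_indic.
Qed.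

Let iindic A y : measurable A ->
  (m i).-integrable setT (fun s => (\1_A (insert_coord i s y))%:E).
Proof.
move=> mA; apply: measurable_bounded_integrable => //.
- by rewrite (le_lt_trans (probability_le1 _ _))// ltry.
- exact: (measurable_fun_pair1 y (mindic mA)).
- exists 1; split => // x x1 t _ /=; apply: (le_trans _ (ltW x1)).
  by rewrite indicE ger0_norm// lern1 leq_b1.
Qed.

Let section_massE A y : measurable A ->
  (section_mass A y)%:E = (\int[m i]_s (\1_A (insert_coord i s y))%:E)%E.
Proof.
move=> mA; rewrite /section_mass fineK//.
by apply: integrable_fin_num => //; exact: iindic.
Qed.

Let ifull A : measurable A -> (m i \x P)%E.-integrable setT
  (fun p => (\1_A (insert_coord i p.1 p.2))%:E).
Proof.
move=> mA; apply: (law_integrable (insert_coord_law m i) (f := EFin \o \1_A)).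
exact: integrable_indic.
Qed.

Let integrable_section_mass A : measurable A ->
  P.-integrable setT (EFin \o section_mass A).
Proof.
move=> mA; apply: eq_integrable (integrable_fubini_G (ifull mA)) => //.
by move=> y _; rewrite /= section_massE.
Qed.

Let integral_section_mass A : measurable A ->
  (\int[P]_y (section_mass A y)%:E = mu A)%E.
Proof.
move=> mA; under eq_integral do rewrite section_massE//.
have := integral21_prod_meas1 (ifull mA); rewrite /fubini_G/= => ->.
have m1A : measurable_fun setT (EFin \o \1_A : d.-tuple R -> \bar R).
  exact/measurable_EFinP/measurable_indic.
rewrite (law_ge0_integral (insert_coord_law m i) m1A).
  by rewrite integral_indic// setIT.
by move=> y; rewrite /= lee_fin.
Qed.

(** Given [y] and [y'], the events on [insert_coord i s y] and on
    [insert_coord i t y'] are independent; so are their conditional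
    probabilities [section_mass A y] and [section_mass B y']. *)
Let insert_pair_lawX A B : measurable A -> measurable B ->
  ((mm \x PP) (insert_pair @^-1` (A `*` B)) = mu A * mu B)%E.
Proof.
move=> mA mB.
have mpre : measurable (insert_pair @^-1` (A `*` B)).
  rewrite -[X in measurable X]setTI; apply: measurable_insert_pair => //.
  exact: measurableX.
have -> : ((mm \x PP) (insert_pair @^-1` (A `*` B)) =
    \int[mm \x PP]_z (\1_(insert_pair @^-1` (A `*` B)) z)%:E)%E.
  have := integral_indic (mm \x PP)%E measurableT mpre.
  by rewrite setIT => ->.
pose f (z : (R * R) * (Y * Y)) : \bar R :=
  (\1_A (insert_coord i z.1.1 z.2.1) * \1_B (insert_coord i z.1.2 z.2.2))%:E.
rewrite (_ : (fun _ => _) = f); last first.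
  apply/funext => z; rewrite /f !indicE -natrM mulnb; congr ((nat_of_bool _)%:R%:E).
  apply/idP/andP; first by rewrite inE => -[/= h1 h2]; rewrite !inE.
  by rewrite !inE => -[h1 h2]; split.
rewrite fubini_tonelli2; last 2 first.
- apply/measurable_EFinP; apply: measurable_funM.
    apply: (measurableT_comp _ (measurableT_comp measurable_fst measurable_insert_pair)).
    exact: measurable_indic.
  apply: (measurableT_comp _ (measurableT_comp measurable_snd measurable_insert_pair)).
  exact: measurable_indic.
- by move=> z; rewrite lee_fin mulr_ge0.
rewrite /fubini_G /f.
transitivity (\int[PP]_y (section_mass A y.1 * section_mass B y.2)%:E)%E.
  apply: eq_integral => y _ /=.
  rewrite (integral_prod_mul (iindic y.1 mA) (iindic y.2 mB)).
  by rewrite EFinM !section_massE.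
rewrite (integral_prod_mul (integrable_section_mass mA) (integrable_section_mass mB)).
by rewrite !integral_section_mass.
Qed.


Lemma insert_pair_law : has_law (mm \x PP)%E insert_pair (mu \x mu)%E.
Proof.
split; first exact: measurable_insert_pair.
move=> C mC; apply/esym.
pose q : {measure set (d.-tuple R * d.-tuple R)%type -> \bar R} :=
  distribution (mm \x PP)%E (mfun_Sub (mem_set measurable_insert_pair)).
rewrite -[RHS]/(q C); apply: product_measure_unique mC => {C} A B mA mB.
exact: insert_pair_lawX.
Qed.

End pair_insertion.

(** * Telescoping the covariance *)

Section coordinates.
Context {R : realType} (d : nat) (i : 'I_d).
Implicit Types (s t u : R) (y : d.-1.-tuple R) (x : d.-tuple R).

Lemma set_coordK x t u :
  set_coord (set_coord x i t) i u = set_coord x i u.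
Proof. by apply: eq_from_tnth => j; rewrite !tnth_mktuple; case: eqP. Qed.

Lemma tnth_set_coord x t : tnth (set_coord x i t) i = t.
Proof. by rewrite tnth_mktuple eqxx. Qed.

Lemma set_coord_insert_coord s t y :
  set_coord (insert_coord i s y) i t = insert_coord i t y.
Proof.
apply: eq_from_tnth => j; rewrite !tnth_mktuple.
by case: (unliftP i j) => [k ->|->]; rewrite ?unlift_none ?eqxx//= ifN// eq_sym neq_lift.
Qed.

(** Only the coordinates other than [i] matter; the value 0 put at [i] is
    always overwritten. *)
Definition splice_base y (y' : d.-1.-tuple R) : d.-tuple R :=
  splice i (insert_coord i 0 y) (insert_coord i 0 y').

Lemma splice_insert_coord s t y (y' : d.-1.-tuple R) :
  splice i (insert_coord i s y) (insert_coord i t y') =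
  set_coord (splice_base y y') i t.
Proof.
apply: eq_from_tnth => j; rewrite !tnth_mktuple.
have [->|ji] := eqVneq j i; first by rewrite ltnn unlift_none.
by case: (unliftP i j) ji => [k ->|->]; rewrite ?eqxx.
Qed.

Lemma splice_atS_insert_coord s t y (y' : d.-1.-tuple R) :
  splice_at i.+1 (insert_coord i s y) (insert_coord i t y') =
  set_coord (splice_base y y') i s.
Proof.
apply: eq_from_tnth => j; rewrite !tnth_mktuple.
have [->|ji] := eqVneq j i; first by rewrite ltnS leqnn unlift_none.
rewrite ltnS leq_eqVlt (inj_eq val_inj) (negbTE ji)/=.
by case: (unliftP i j) ji => [k ->|->]; rewrite ?eqxx.
Qed.

End coordinates.

Section representation.
Context {R : realType} (d : nat) (m : 'I_d -> probability R R).
Variables (f g : d.-tuple R -> R).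
Notation mu := (product_probability m).
Hypotheses (f_ac : coordinatewise_absolutely_continuous f)
    (g_ac : coordinatewise_absolutely_continuous g)
    (f_L2 : f \in Lfun mu 2%:E)
    (g_L2 : g \in Lfun mu 2%:E).

(** Both factors are square integrable since a spliced point has law [mu]. *)
Lemma L2_splice_at_mul_integrable j k :
  (mu \x mu)%E.-integrable setT
    (fun p => (f (splice_at j p.1 p.2) * g (splice_at k p.1 p.2))%:E).
Proof.
have mf : measurable_fun setT f.
  by move: f_L2; rewrite inE => /andP[+ _]; rewrite inE.
have mg : measurable_fun setT g.
  by move: g_L2; rewrite inE => /andP[+ _]; rewrite inE.
have if2 := law_integrable (splice_at_law m j) (Lfun2_integrable_sqr f_L2).
have ig2 := law_integrable (splice_at_law m k) (Lfun2_integrable_sqr g_L2).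
apply: le_integrable (integrableD measurableT if2 ig2) => //.
  apply/measurable_EFinP; apply: measurable_funM.
    exact: measurableT_comp mf (measurable_splice_at j).
  exact: measurableT_comp mg (measurable_splice_at k).
move=> p _; set a := f (splice_at j p.1 p.2); set b := g (splice_at k p.1 p.2).
rewrite -[leRHS]/(`|a ^+ 2 + b ^+ 2|%:E) lee_fin normrM.
rewrite [leRHS]ger0_norm ?addr_ge0 ?sqr_ge0//.
rewrite -(real_normK (num_real a)) -(real_normK (num_real b)).
have := sqr_ge0 (`|a| - `|b|); have := sqr_ge0 (`|a| + `|b|).
by nra.
Qed.

Definition covariance_increment i (p : d.-tuple R * d.-tuple R) : R :=
  f p.1 * (g (splice_at i.+1 p.1 p.2) - g (splice_at i p.1 p.2)).

Lemma increment_integrable i : (mu \x mu)%E.-integrable setT (EFin \o covariance_increment i).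
Proof.
have := integrableB measurableT (L2_splice_at_mul_integrable d i.+1)
  (L2_splice_at_mul_integrable d i).
apply: eq_integrable => // p _ /=.
by rewrite !splice_at_full -EFinB -mulrBr.
Qed.

Section one_coordinate.
Variable i : 'I_d.
Hypothesis abs_cvg : (representation_measure m i).-integrable [set: _]
        (EFin \o representation_integrand m i f g).
Let mm : probability (R * R)%type R := (m i \x m i)%E.
Let PP := product_probability_except2 m i.
Notation Y := (d.-1.-tuple R).
Let phi (y : Y * Y) t := f (insert_coord i t y.1).
Let psi (y : Y * Y) t := g (set_coord (splice_base i y.1 y.2) i t).

Let phi_ac y : locally_ac (phi y).
Proof.
apply: absolutely_continuous_locally_ac.
rewrite (_ : phi y = fun t => f (set_coord (insert_coord i 0 y.1) i t)).
  exact: f_ac.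
by apply/funext => t; rewrite set_coord_insert_coord.
Qed.

Let psi_ac y : locally_ac (psi y).
Proof. by apply: absolutely_continuous_locally_ac; exact: g_ac. Qed.

Let incrementE st y : covariance_increment i (insert_pair i (st, y)) =
  phi y st.1 * (psi y st.1 - psi y st.2).
Proof.
rewrite /covariance_increment /insert_pair/= splice_atS_insert_coord.
by rewrite -[splice_at i _ _]/(splice i _ _) splice_insert_coord.
Qed.

Let integrandE st y : representation_integrand m i f g (st, y) =
  derive1 (phi y) st.1 * covariance_kernel (m i) st.1 st.2 * derive1 (psi y) st.2.
Proof.
have fE : partial i f (insert_coord i st.1 y.1) = derive1 (phi y) st.1.
  rewrite /partial tnth_insert_coord.
  suff -> : (fun t => f (set_coord (insert_coord i st.1 y.1) i t)) = phi y by [].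
  by apply/funext => t; rewrite set_coord_insert_coord.
have gE : partial i g (set_coord (splice_base i y.1 y.2) i st.2) =
    derive1 (psi y) st.2.
  rewrite /partial tnth_set_coord.
  suff -> : (fun t => g (set_coord
      (set_coord (splice_base i y.1 y.2) i st.2) i t)) = psi y by [].
  by apply/funext => t; rewrite set_coordK.
by rewrite /representation_integrand/= splice_insert_coord !tnth_insert_coord fE gE.
Qed.

(** Conditionally on the coordinates other than [i], this is Hoeffding's formula
    for the sections [phi y] and [psi y]; the absolute convergence of both sides
    holds for almost every [y] by Fubini's theorem. *)
Lemma integral_increment :
  (\int[mu \x mu]_p (covariance_increment i p)%:E =
   \int[representation_measure m i]_z (representation_integrand m i f g z)%:E)%E.
Proof.
have i1 : (mm \x PP)%E.-integrable setT
    (EFin \o covariance_increment i \o insert_pair i).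
  exact: (law_integrable (insert_pair_law m i) (increment_integrable i)).
rewrite -(law_integral (insert_pair_law m i) (increment_integrable i)).
have i2 : (@lebesgue_square R \x PP)%E.-integrable setT
  (EFin \o representation_integrand m i f g) := abs_cvg.
transitivity (\int[PP]_y \int[mm]_st (covariance_increment i (insert_pair i (st, y)))%:E)%E.
  by rewrite (integral21_prod_meas1 i1).
transitivity (\int[PP]_y \int[@lebesgue_square R]_st
    (representation_integrand m i f g (st, y))%:E)%E; last first.
  exact: (integral21_prod_meas1 i2).
apply: ae_eq_integral => //.
- exact: measurable_fubini_G i1.
- exact: measurable_fubini_G i2.
apply: ae_mono2 (ae_integrable2 i1) (ae_integrable2 i2) => y iy1 iy2 _.
under eq_integral do rewrite incrementE.
under [RHS]eq_integral do rewrite integrandE.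
apply: hoeffding_formula => //.
- by apply: eq_integrable iy1 => // st _; rewrite /= incrementE.
- by apply: eq_integrable iy2 => // st _; rewrite /= integrandE.
Qed.

End one_coordinate.

(** [c k] is [E (f(X) g(S_k))]: it goes from [E f * E g] at [k = 0] to [E (f g)]
    at [k = d]. *)
Lemma covariance_telescope : covariance mu f g =
  (\sum_(i < d) \int[mu \x mu]_p (covariance_increment i p)%:E)%E.
Proof.
have f_L1 : f \in Lfun mu 1 by apply: Lfun_subset12 f_L2; exact: fin_num_measure.
have g_L1 : g \in Lfun mu 1 by apply: Lfun_subset12 g_L2; exact: fin_num_measure.
have fg_L1 : f * g \in Lfun mu 1 by exact: Lfun2_mul_Lfun1.
rewrite covarianceE//.
have icross k : (mu \x mu)%E.-integrable setT
    (fun p => (f p.1 * g (splice_at k p.1 p.2))%:E).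
  apply: eq_integrable (L2_splice_at_mul_integrable d k) => // p _.
  by rewrite splice_at_full.
pose c k := fine (\int[mu \x mu]_p (f p.1 * g (splice_at k p.1 p.2))%:E).
have cE k : (c k)%:E = (\int[mu \x mu]_p (f p.1 * g (splice_at k p.1 p.2))%:E)%E.
  by rewrite /c fineK//; apply: integrable_fin_num.
transitivity (c d - c 0)%:E.
  rewrite EFinB !cE; congr (_ - _)%E.
    rewrite unlock -(law_integral (splice_at_law m d)); last exact/Lfun1_integrable.
    by apply: eq_integral => p _; rewrite splice_at_full.
  under eq_integral do rewrite splice_at0.
  rewrite integral_prod_mul; [|exact/Lfun1_integrable..].
  by rewrite unlock.
rewrite -(telescope_sumr c (leq0n d)) big_mkord -sumEFin; apply: eq_bigr => k _.
rewrite EFinB !cE -integralB//; apply: eq_integral => p _.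
by rewrite /covariance_increment mulrBr EFinB.
Qed.

End representation.

Theorem proposition7p2 (R : realType) (d : nat)
    (mu : 'I_d -> probability R R) (f g : d.-tuple R -> R)
    (f_ac : coordinatewise_absolutely_continuous f)
    (g_ac : coordinatewise_absolutely_continuous g)
    (f_L2 : f \in Lfun (product_probability mu) 2%:E)
    (g_L2 : g \in Lfun (product_probability mu) 2%:E)
    (abs_cvg : forall i : 'I_d,
      (representation_measure mu i).-integrable [set: _]
        (EFin \o representation_integrand mu i f g)) :
  covariance (product_probability mu) f g =
  (\sum_(i < d) \int[representation_measure mu i]_z
     (representation_integrand mu i f g z)%:E)%E.
Proof.
rewrite covariance_telescope//; apply: eq_bigr => i _.
exact: integral_increment.
Qed.
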